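(* Let $A\in\mathbb{R}^{m\times n}$ have nonzero rows $a_1^\top,\dots,a_m^\top$ with $\operatorname{rank}(A)\ge 2$, let $b\in\mathbb{R}^m$ be such that the linear system $Ax=b$ is consistent, let $\alpha\in(0,1)$, and let $x^0\in\mathbb{R}^n$ be arbitrary. Put $x_*^0=A^\dagger b+(I-A^\dagger A)x^0$. Let $\{x^k\}_{k\ge0}$ be generated by the PRDR method (see context). Then for all $k\ge 0$: (i) if the indices are selected by Strategy I, then $$\mathbb{E}\left[\|x^k-x_*^0\|_2^2\right]\le\left(1-4\alpha(1-\alpha)\frac{\sigma_{\min}^2(M^{1/2}A)}{\|A\|_F^2}\right)^k\|x^0-x_*^0\|_2^2;$$ (ii) if the indices are selected by Strategy II, then $$\mathbb{E}\left[\|x^k-x_*^0\|_2^2\right]\le\left(1-8\alpha(1-\alpha)\frac{\sigma_{\min}^2(N^{1/2}A)}{\|A\|_F^4-\|AA^\top\|_F^2}\right)^k\|x^0-x_*^0\|_2^2.$$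
   Context: Notation: $[m]=\{1,\dots,m\}$; $A^\dagger$ is the Moore–Penrose pseudoinverse; $\|\cdot\|_F$ is the Frobenius norm; $\sigma_{\min}(B)$ is the smallest nonzero singular value of a matrix $B$; $A_{\mathcal S}$ is the row submatrix of $A$ indexed by $\mathcal S\subseteq[m]$. For $i\in[m]$, $\mathcal{H}_i=\{x\in\mathbb{R}^n:\langle a_i,x\rangle=b_i\}$ and the reflection is $\mathcal{R}_{\mathcal{H}_i}(x)=x-2\frac{\langle a_i,x\rangle-b_i}{\|a_i\|_2^2}a_i$. PRDR method: starting from $x^0$, at each iteration $k=0,1,2,\dots$ a pair of indices $i_{k_1},i_{k_2}\in[m]$ is drawn (independently of the previous iterations) by Strategy I or by Strategy II, and $$x^{k+1}=(1-\alpha)x^k+\alpha z^k,\qquad z^k=\mathcal{R}_{\mathcal{H}_{i_{k_2}}}\mathcal{R}_{\mathcal{H}_{i_{k_1}}}(x^k).$$ Strategy I (without-replacement sampling): $\mathbb{P}(i_{k_1}=i)=\frac{\|a_i\|_2^2}{\|A\|_F^2}$ for $i\in[m]$ and, given $i_{k_1}$, $\mathbb{P}(i_{k_2}=j)=\frac{\|a_j\|_2^2}{\|A\|_F^2-\|a_{i_{k_1}}\|_2^2}$ for $j\ne i_{k_1}$. Strategy II (volume sampling): the two-element set $\mathcal{S}_k=\{i_{k_1},i_{k_2}\}\subseteq[m]$ satisfies $\mathbb{P}(\mathcal{S}_k=\mathcal{S})=\frac{\det(A_{\mathcal S}A_{\mathcal S}^\top)}{\sum_{\mathcal J}\det(A_{\mathcal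 J}A_{\mathcal J}^\top)}$ for every two-element $\mathcal S\subseteq[m]$, where $\mathcal J$ ranges over all two-element subsets of $[m]$; the order in which the two elements are labelled $i_{k_1},i_{k_2}$ is arbitrary. Matrix $M\in\mathbb{R}^{m\times m}$: with $\Delta=\sum_{j=1}^m\frac{\|a_j\|_2^2}{\|A\|_F^2-\|a_j\|_2^2}$, set $M_{ii}=\Delta+1-\frac{\|a_i\|_2^2}{\|A\|_F^2-\|a_i\|_2^2}$ and $M_{ij}=-\frac{2\langle a_i,a_j\rangle}{\|A\|_F^2-\|a_j\|_2^2}$ for $i\ne j$. One has $y^\top My>0$ for all $y\ne0$. $M^{1/2}$ denotes the symmetric positive definite square root of the symmetric part $\frac12(M+M^\top)$, so that $\|M^{1/2}y\|_2^2=y^\top My$ for all $y\in\mathbb{R}^m$ (this is the usual square root whenever $M$ is symmetric). Matrix $N\in\mathbb{R}^{m\times m}$: with $g_{i,j}=1-\frac{\langle a_i,a_j\rangle^2}{\|a_i\|_2^2\|a_j\|_2^2}$, set $N_{ii}=\sum_{j=1}^m g_{i,j}\|a_j\|_2^2$ and $N_{ij}=-g_{i,j}\langle a_i,a_j\rangle$ for $i\ne j$. $N$ is symmetric positive definite and $N^{1/2}$ is its symmetric positive definite square root. *)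

(* Defs.v *)
From HB Require Import structures.
From mathcomp Require Import all_boot all_order all_algebra.
From mathcomp Require Import all_classical all_reals all_analysis.

Set Implicit Arguments.
Unset Strict Implicit.
Unset Printing Implicit Defensive.

Import Order.TTheory GRing.Theory Num.Theory.

Local Open Scope classical_set_scope.
Local Open Scope ring_scope.

Section LinearAlgebra.
Variable R : realType.

Definition dotp (n : nat) (u v : 'cV[R]_n) : R := \sum_(i < n) u i 0 * v i 0.

(* The norm that MathComp-Analysis puts on matrices is the sup norm, hence
   these two. *)
Definition norm2 (n : nat) (u : 'cV[R]_n) : R := Num.sqrt (dotp u u).

Definition normF (m n : nat) (A : 'M[R]_(m, n)) : R :=
  Num.sqrt (\sum_(i < m) \sum_(j < n) A i j ^+ 2).

Definition is_pinv (m n : nat) (A : 'M[R]_(m, n)) (X : 'M[R]_(n, m)) : Prop :=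
  [/\ A *m X *m A = A, X *m A *m X = X,
      (A *m X)^T = A *m X & (X *m A)^T = X *m A].

(* The matrix satisfying the Penrose equations: see [pinvP] and
   [is_pinv_uniq]. *)
Definition pinv (m n : nat) (A : 'M[R]_(m, n)) : 'M[R]_(n, m) :=
  xget 0 [set X | is_pinv A X].

Definition singular_value (m n : nat) (B : 'M[R]_(m, n)) (s : R) : Prop :=
  0 <= s /\ eigenvalue (B^T *m B) (s ^+ 2).

(* The set is finite, and nonempty when [B != 0]: the infimum is then its
   least element. *)
Definition sigma_min (m n : nat) (B : 'M[R]_(m, n)) : R :=
  inf [set s | singular_value B s /\ s != 0].

Definition posdef (n : nat) (S : 'M[R]_n) : Prop :=
  forall y : 'cV[R]_n, y != 0 -> 0 < dotp y (S *m y).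

Definition is_spd_sqrt (n : nat) (S B : 'M[R]_n) : Prop :=
  [/\ B^T = B, posdef B & B *m B = S].

(* [is_spd_sqrt S] has exactly one solution when [S] is symmetric positive
   definite; the default value [0] is irrelevant in that case. *)
Definition spd_sqrt (n : nat) (S : 'M[R]_n) : 'M[R]_n :=
  xget 0 [set B | is_spd_sqrt S B].

Definition sympart (n : nat) (S : 'M[R]_n) : 'M[R]_n := 2^-1 *: (S + S^T).

Lemma dotp_eq0 (n : nat) (u : 'cV[R]_n) : dotp u u = 0 -> u = 0.
Proof.
move=> /eqP; rewrite psumr_eq0 => [/allP h|i _]; last by rewrite -expr2 sqr_ge0.
apply/colP => i; rewrite mxE; apply/eqP.
by have := h i (mem_index_enum i); rewrite /= mulf_eq0 orbb.
Qed.

Lemma mul_tr_eq0 (m n : nat) (C : 'M[R]_(m, n)) : C^T *m C = 0 -> C = 0.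
Proof.
move=> C0; apply/matrixP => i j.
have /dotp_eq0/colP/(_ i) : dotp (col j C) (col j C) = 0.
  move/matrixP/(_ j j): C0; rewrite !mxE => C0.
  by rewrite -[RHS]C0; apply: eq_bigr => l _; rewrite !mxE.
by rewrite !mxE.
Qed.

Lemma gram_unit (m n : nat) (C : 'M[R]_(m, n)) :
  row_free C -> C *m C^T \in unitmx.
Proof.
move=> fC; rewrite -row_free_unit -kermx_eq0.
set K := kermx _; have K0 : K *m (C *m C^T) = 0 by apply: mulmx_ker.
have KC0 : (K *m C)^T = 0.
  apply: mul_tr_eq0; rewrite trmxK trmx_mul.
  by rewrite mulmxA -(mulmxA K) K0 mul0mx.
apply/eqP/(row_free_inj fC).
by rewrite mul0mx -[LHS]trmxK KC0 trmx0.
Qed.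

Lemma is_pinv_fact (m n r : nat) (C : 'M[R]_(m, r)) (F : 'M[R]_(r, n)) :
  F *m F^T \in unitmx -> C^T *m C \in unitmx ->
  is_pinv (C *m F) (F^T *m invmx (F *m F^T) *m invmx (C^T *m C) *m C^T).
Proof.
move=> uF uC; set P := invmx (F *m F^T); set Q := invmx (C^T *m C).
have PT : P^T = P by rewrite trmx_inv trmx_mul trmxK.
have QT : Q^T = Q by rewrite trmx_inv trmx_mul trmxK.
have AX : C *m F *m (F^T *m P *m Q *m C^T) = C *m Q *m C^T.
  by rewrite !mulmxA -(mulmxA C F) -(mulmxA C) mulmxV // mulmx1.
have XA : (F^T *m P *m Q *m C^T) *m (C *m F) = F^T *m P *m F.
  by rewrite !mulmxA -(mulmxA _ C^T) -(mulmxA _ Q) mulVmx // mulmx1.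
split.
- by rewrite AX !mulmxA -(mulmxA _ C^T) -(mulmxA C Q) mulVmx // mulmx1.
- by rewrite XA !mulmxA -(mulmxA _ F F^T) -(mulmxA _ P (F *m _)) mulVmx //
             mulmx1.
- by rewrite AX !trmx_mul trmxK QT mulmxA.
- by rewrite XA !trmx_mul trmxK PT mulmxA.
Qed.

Lemma pinvP (m n : nat) (A : 'M[R]_(m, n)) : is_pinv A (pinv A).
Proof.
apply: (@xgetPex _ 0 [set X | is_pinv A X]).
have uF : row_base A *m (row_base A)^T \in unitmx.
  exact/gram_unit/row_base_free.
have uC : (col_base A)^T *m col_base A \in unitmx.
  rewrite -{2}[col_base A]trmxK; apply: gram_unit.
  by rewrite /row_free mxrank_tr -/(row_full _) col_base_full.
by eexists; rewrite /= -{1}(mulmx_base A); exact: is_pinv_fact uF uC.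
Qed.

Lemma is_pinv_uniq (m n : nat) (A : 'M[R]_(m, n)) (X Y : 'M[R]_(n, m)) :
  is_pinv A X -> is_pinv A Y -> X = Y.
Proof.
move=> [x1 x2 x3 x4] [y1 y2 y3 y4].
have eAX : A *m X = A *m Y.
  by rewrite -{1}y1 -mulmxA -{1}y3 -{1}x3 -trmx_mul mulmxA x1 y3.
have eXA : X *m A = Y *m A.
  by rewrite -{1}y1 -(mulmxA A) mulmxA -{1}x4 -{1}y4 -trmx_mul -mulmxA
             (mulmxA A) x1 y4.
by rewrite -x2 eXA -mulmxA eAX mulmxA y2.
Qed.

End LinearAlgebra.

Section PRDR.
Variables (R : realType) (m n : nat).
Implicit Types (A : 'M[R]_(m, n)) (b : 'cV[R]_m) (x : 'cV[R]_n).

Definition rowv A (i : 'I_m) : 'cV[R]_n := (row i A)^T.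

Definition reflection A b (i : 'I_m) x : 'cV[R]_n :=
  x - (2 * ((dotp (rowv A i) x - b i 0) / norm2 (rowv A i) ^+ 2)) *: rowv A i.

Fixpoint prdr A b (alpha : R) x (s : nat -> 'I_m * 'I_m) (k : nat) :
    'cV[R]_n :=
  if k is k'.+1 then
    let xk := prdr A b alpha x s k' in
    let zk := reflection A b (s k').2 (reflection A b (s k').1 xk) in
    (1 - alpha) *: xk + alpha *: zk
  else x.

Definition xstar A b x : 'cV[R]_n := pinv A *m b + (1%:M - pinv A *m A) *m x.

Definition sub_rows A (S : {set 'I_m}) : 'M[R]_(#|S|, n) :=
  rowsub (fun i : 'I_#|S| => enum_val i) A.

Definition vol A (S : {set 'I_m}) : R :=
  \det (sub_rows A S *m (sub_rows A S)^T).

Definition deltaM A : R :=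
  \sum_(j < m) norm2 (rowv A j) ^+ 2 / (normF A ^+ 2 - norm2 (rowv A j) ^+ 2).

Definition matM A : 'M[R]_m :=
  \matrix_(i, j)
    if i == j then
      deltaM A + 1
        - norm2 (rowv A i) ^+ 2 / (normF A ^+ 2 - norm2 (rowv A i) ^+ 2)
    else
      - (2 * dotp (rowv A i) (rowv A j)
           / (normF A ^+ 2 - norm2 (rowv A j) ^+ 2)).

Definition gN A (i j : 'I_m) : R :=
  1 - dotp (rowv A i) (rowv A j) ^+ 2
        / (norm2 (rowv A i) ^+ 2 * norm2 (rowv A j) ^+ 2).

Definition matN A : 'M[R]_m :=
  \matrix_(i, j)
    if i == j then \sum_(l < m) gN A i l * norm2 (rowv A l) ^+ 2
    else - (gN A i j * dotp (rowv A i) (rowv A j)).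

Definition sqrtM A : 'M[R]_m := spd_sqrt (sympart (matM A)).

Definition sqrtN A : 'M[R]_m := spd_sqrt (matN A).

End PRDR.

Section Sampling.
Context {d : measure_display} {T : measurableType d} {R : realType}.
Variable P : probability T R.

Definition cond_prob (E F : set T) : R := fine (P (E `&` F)) / fine (P F).

(* For each [k], the discrete variable [X k] is independent of
   [(Y 0, ..., Y k.-1)]. *)
Definition indep_past (U V : Type) (X : nat -> T -> U) (Y : nat -> T -> V) :
    Prop :=
  forall (k : nat) (u : U) (h : nat -> V),
    let past := [set w | forall j, (j < k)%N -> Y j w = h j] in
    P ([set w | X k w = u] `&` past) = (P [set w | X k w = u] * P past)%E.

Variables m n : nat.
Implicit Types (A : 'M[R]_(m, n)) (idx : nat -> T -> 'I_m * 'I_m).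

Definition measurable_indices idx : Prop :=
  forall k p, measurable [set w | idx k w = p].

Definition idx_set idx (k : nat) (w : T) : {set 'I_m} :=
  [set (idx k w).1; (idx k w).2]%SET.

Definition strategyI A idx : Prop :=
  [/\ measurable_indices idx,
      indep_past idx idx,
      forall k i, P [set w | (idx k w).1 = i] =
        (norm2 (rowv A i) ^+ 2 / normF A ^+ 2)%:E
    & forall k i j, j != i ->
        cond_prob [set w | (idx k w).2 = j] [set w | (idx k w).1 = i] =
        norm2 (rowv A j) ^+ 2 / (normF A ^+ 2 - norm2 (rowv A i) ^+ 2)].

(* Only the unordered pair drawn at step [k] has to be independent of the past:
   its labelling may depend on the past in an arbitrary way. *)
Definition strategyII A idx : Prop :=
  [/\ measurable_indices idx,
      indep_past (idx_set idx) idx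
    & forall k (S : {set 'I_m}), #|S| = 2 ->
        P [set w | idx_set idx k w = S] =
        (vol A S / \sum_(J : {set 'I_m} | #|J| == 2) vol A J)%:E].

End Sampling.

(* Main.v *)
Require Import Defs.
From mathcomp Require Import all_boot all_order all_algebra.
From mathcomp Require Import all_classical all_reals all_analysis.
From mathcomp Require Import ring lra.

Set Implicit Arguments.
Unset Strict Implicit.
Unset Printing Implicit Defensive.

Import Order.TTheory GRing.Theory Num.Theory.
Import numFieldNormedType.Exports.
Local Open Scope classical_set_scope.
Local Open Scope ring_scope.

(** Consistency makes [xstar] a solution of the system, so each reflection acts
on the error e = x - xstar as the linear reflection in the hyperplane orthogonal
to a row, and these are isometries. Expanding the square of
(1 - alpha) e + alpha R_j R_i e then leaves a single unknown, the scalar product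
of e with R_j R_i e, which gives the exact identity ([relaxed_step])
<<
  |e'|^2 = |e|^2 - 4 alpha (1 - alpha) gain(i, j),
  gain(i, j) = y_i^2/|a_i|^2 + y_j^2/|a_j|^2
               - 2 y_i y_j <a_i, a_j> / (|a_i|^2 |a_j|^2),   y = A e.
>>
The gain is nonnegative, symmetric in i and j, and zero for i = j. The symmetry
is what lets volume sampling leave the order of the two reflections arbitrary.

The matrices M and N are built so that the mean gain is a quadratic form in y:
it is y^T M y / |A|_F^2 for sampling without replacement ([sum_gain_matM]), and
y^T N y divided by the sum of the 2 x 2 principal Gram minors for volume
sampling ([sum_vol_gain]); that sum is (|A|_F^4 - |A A^T|_F^2) / 2 ([sum_vol]).

It remains to bound y^T S y below by sigma_min(S^{1/2} A)^2 |e|^2. The error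
starts in the range of A^T, because x0 - xstar is the projection onto it of the
difference between x0 and a solution, and reflections keep it there. On the
range of the transpose of a matrix C, |C e|^2 is at least sigma_min(C)^2 |e|^2:
a minimiser of |C e|^2 on the unit sphere of that range exists by compactness
and is an eigenvector of C^T C for a nonzero eigenvalue ([sigma_min_le]).

Finally, the state after k steps depends on k draws from a finite set, and so
expectations are finite sums over histories; independence of the next draw from
the past factorises these sums, and the one-step bound holds conditionally on
every history ([chain_contraction]). *)

(** * Euclidean scalar product *)

Section DotProduct.
Variable R : realType.
Implicit Types (n p : nat).

Lemma dotpE n (u v : 'cV[R]_n) : dotp u v = (u^T *m v) 0 0.
Proof. by rewrite mxE; apply: eq_bigr => i _; rewrite !mxE. Qed.

Lemma dotpC n (u v : 'cV[R]_n) : dotp u v = dotp v u.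
Proof. by apply: eq_bigr => i _; rewrite mulrC. Qed.

Lemma dotpDl n (u v w : 'cV[R]_n) : dotp (u + v) w = dotp u w + dotp v w.
Proof. by rewrite !dotpE linearD mulmxDl mxE. Qed.

Lemma dotpDr n (u v w : 'cV[R]_n) : dotp w (u + v) = dotp w u + dotp w v.
Proof. by rewrite dotpC dotpDl !(dotpC _ w). Qed.

Lemma dotpZl n a (u v : 'cV[R]_n) : dotp (a *: u) v = a * dotp u v.
Proof. by rewrite !dotpE linearZ /= -scalemxAl mxE. Qed.

Lemma dotpZr n a (u v : 'cV[R]_n) : dotp v (a *: u) = a * dotp v u.
Proof. by rewrite dotpC dotpZl dotpC. Qed.

Lemma dotpNl n (u v : 'cV[R]_n) : dotp (- u) v = - dotp u v.
Proof. by rewrite -scaleN1r dotpZl mulN1r. Qed.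

Lemma dotpNr n (u v : 'cV[R]_n) : dotp v (- u) = - dotp v u.
Proof. by rewrite dotpC dotpNl dotpC. Qed.

Definition dotp_lin := (dotpDl, dotpDr, dotpZl, dotpZr, dotpNl, dotpNr).

Lemma dotp_mulmxl n p (B : 'M[R]_(p, n)) (u : 'cV[R]_n) (v : 'cV[R]_p) :
  dotp (B *m u) v = dotp u (B^T *m v).
Proof. by rewrite !dotpE trmx_mul mulmxA. Qed.

Lemma dotp_ge0 n (u : 'cV[R]_n) : 0 <= dotp u u.
Proof. by apply: sumr_ge0 => i _; rewrite -expr2 sqr_ge0. Qed.

Lemma norm2_sqr n (u : 'cV[R]_n) : norm2 u ^+ 2 = dotp u u.
Proof. by rewrite sqr_sqrtr // dotp_ge0. Qed.

Lemma dotp_gt0 n (u : 'cV[R]_n) : u != 0 -> 0 < dotp u u.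
Proof.
by rewrite lt_def dotp_ge0 andbT; apply: contra_neq => /dotp_eq0.
Qed.

End DotProduct.

(** * Smallest nonzero singular value *)

Lemma continuous_quad (R : realType) (n : nat) (D : 'M[R]_n) :
  continuous (fun v : 'rV[R]_n => (v *m D *m v^T) 0 0).
Proof.
have -> : (fun v : 'rV[R]_n => (v *m D *m v^T) 0 0) =
    (fun v => \sum_j (\sum_i v 0 i * D i j) * v 0 j).
  apply/funext => v; rewrite mxE; apply: eq_bigr => j _.
  by rewrite !mxE.
apply: continuous_big => [|j _]; first exact: add_continuous.
have cont : continuous (fun v : 'rV[R]_n => \sum_i v 0 i * D i j).
  apply: continuous_big => [|i _]; first exact: add_continuous.
  move=> v; apply: (@continuousM R _ (fun v : 'rV[R]_n => v 0 i)
    (fun=> D i j)); last exact: cst_continuous.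
  exact: (@coord_continuous R 1 n 0 i v).
move=> v; apply: (@continuousM R _ _ (fun v : 'rV[R]_n => v 0 j)).
  exact: cont.
exact: (@coord_continuous R 1 n 0 j v).
Qed.

Section Rayleigh.
Variables (R : realType) (p n : nat) (C : 'M[R]_(p, n)).

(** The orthogonal projection onto the range of the transpose of [C]. *)
Let Pi : 'M[R]_n := Defs.pinv C *m C.

Let PiT : Pi^T = Pi. Proof. by case: (pinvP C). Qed.

Let CPi : C *m Pi = C. Proof. by rewrite mulmxA; case: (pinvP C). Qed.

Let Pi_range (z : 'cV[R]_p) : Pi *m (C^T *m z) = C^T *m z.
Proof. by rewrite mulmxA -{1}PiT -trmx_mul CPi. Qed.

Let ray (v : 'cV[R]_n) := dotp (C *m v) (C *m v).

(** The unit sphere of the range of [C^T] is compact, and nonempty as soon as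
this range contains a nonzero vector. *)
Lemma rayleigh_min (u0 : 'cV[R]_n) : Pi *m u0 = u0 -> u0 != 0 ->
  exists v : 'cV[R]_n, [/\ Pi *m v = v, dotp v v = 1 &
    forall e : 'cV[R]_n, Pi *m e = e -> ray v * dotp e e <= ray e].
Proof.
move=> Pu0 u0n0.
have rayE (v : 'rV[R]_n) : ray v^T = (v *m (C^T *m C) *m v^T) 0 0.
  by rewrite /ray dotpE trmx_mul trmxK !mulmxA.
have dotE (v : 'rV[R]_n) : dotp v^T v^T = (v *m 1%:M *m v^T) 0 0 :> R.
  by rewrite dotpE trmxK mulmx1.
(* Both constraints are level sets of quadratic forms, hence closed. *)
pose D := (1%:M - Pi) *m (1%:M - Pi)^T.
have projE (v : 'rV_n) : Pi *m v^T = v^T <-> (v *m D *m v^T) 0 0 = 0.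
  have -> : (v *m D *m v^T) 0 0 = dotp (v^T - Pi *m v^T) (v^T - Pi *m v^T).
    have -> : v^T - Pi *m v^T = (1%:M - Pi)^T *m v^T.
      by rewrite linearB /= trmx1 PiT mulmxBl mul1mx.
    by rewrite dotpE trmx_mul !trmxK !mulmxA.
  split=> [->|/dotp_eq0/eqP]; first by rewrite subrr dotpE mulmx0 mxE.
  by rewrite subr_eq0 => /eqP.
pose K := [set v : 'rV[R]_n | (v *m D *m v^T) 0 0 = 0] `&`
          [set v | (v *m 1%:M *m v^T) 0 0 = 1].
have cK : compact K.
  apply: (@subclosed_compact _ K
    [set v : 'rV[R]_n | forall i, v ord0 i \in `[-1, 1]]).
  - by apply: closedI; apply: (closed_comp _ (@closed_eq R _)) => v _;
       exact: continuous_quad.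
  - by apply: (@rV_compact R n (fun=> [set` `[-1, 1]])) => i;
       exact: segment_compact.
  - move=> v [_ /= v1] i; rewrite in_itv /= -ler_norml.
    have : v ord0 i ^+ 2 <= 1.
      rewrite -v1 -dotE /dotp (bigD1 i) //= !mxE -expr2 lerDl.
      by apply: sumr_ge0 => j _; rewrite -expr2 sqr_ge0.
    by rewrite -(real_normK (num_real _)) expr_le1.
have unit_in (e : 'cV_n) : e != 0 -> Pi *m e = e ->
    K ((Num.sqrt (dotp e e))^-1 *: e)^T.
  move=> e0 Pe; set a := _^-1.
  have a2 : a ^+ 2 * dotp e e = 1.
    by rewrite exprVn sqr_sqrtr ?dotp_ge0 // mulVf // gt_eqF // dotp_gt0.
  split.
    by apply/projE; rewrite trmxK -scalemxAr Pe.
  by rewrite /= -dotE trmxK !dotp_lin mulrA -expr2.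
have K0 : K !=set0.
  by exists ((Num.sqrt (dotp u0 u0))^-1 *: u0)^T; exact: unit_in.
have [|v vK vmin] :=
    EVT_min_rV (f := fun v => (v *m (C^T *m C) *m v^T) 0 0) K0 cK.
  exact/continuous_subspaceT/continuous_quad.
move: (set_mem vK) => [/projE Pv v1].
exists v^T; split=> //; first by rewrite dotE.
move=> e Pe; have [->|e0] := eqVneq e 0.
  by rewrite /ray mulmx0 !dotpE !mulmx0 !mxE mulr0.
have := vmin _ (mem_set (unit_in _ e0 Pe)).
rewrite -!rayE trmxK /ray -scalemxAr !dotp_lin mulrA -expr2 exprVn.
by rewrite sqr_sqrtr ?dotp_ge0 // ler_pdivlMl ?dotp_gt0 // mulrC.
Qed.

(** First-order condition: the residual [r] of the eigenvalue equation lies in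
the range of [C^T], so it is an admissible direction, along which the quadratic
form [ray e - ray v * dotp e e] is nonnegative and vanishes at [v]; its
derivative there is [2 * dotp r r]. *)
Lemma rayleigh_min_eigen (v : 'cV[R]_n) : Pi *m v = v -> dotp v v = 1 ->
  (forall e : 'cV[R]_n, Pi *m e = e -> ray v * dotp e e <= ray e) ->
  C^T *m C *m v = ray v *: v.
Proof.
move=> Pv v1 vmin; apply/eqP; rewrite -subr_eq0; set r := _ - _.
apply/eqP/dotp_eq0.
have Pr : Pi *m r = r.
  by rewrite /r mulmxBr -scalemxAr Pv -(mulmxA C^T) Pi_range.
have rE : C^T *m C *m v = r + ray v *: v by rewrite /r subrK.
clearbody r; have h t :
    0 <= 2 * t * dotp r r + t ^+ 2 * (ray r - ray v * dotp r r).
  have := vmin (v + t *: r); rewrite mulmxDr -scalemxAr Pv Pr => /(_ erefl).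
  rewrite /ray mulmxDr -scalemxAr -/(ray v) !dotp_lin -!/(ray _) v1.
  rewrite (dotpC r v) (dotpC (C *m r)).
  have -> : dotp (C *m v) (C *m r) = dotp r r + ray v * dotp v r.
    by rewrite dotpC dotp_mulmxl mulmxA rE dotpDr dotpZr (dotpC v).
  by lra.
set s := dotp r r in h *; set q := ray r - _ in h.
have s0 : 0 <= s by exact: dotp_ge0.
have q0 : 0 <= q by rewrite subr_ge0 vmin.
apply/eqP; rewrite eq_le s0 andbT.
have [qe|qn] := eqVneq q 0; first by have := h (-1); rewrite qe; lra.
(* The parabola [h] takes its least value here, and it is [- s ^+ 2 / q]. *)
have := h (- (s / q)).
have -> : 2 * - (s / q) * s + (- (s / q)) ^+ 2 * q = - (s ^+ 2 / q) by field.
rewrite oppr_ge0 pmulr_lle0 ?invr_gt0 ?lt_def ?qn // => s2.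
by have := sqr_ge0 s; nra.
Qed.

(** Restricting to the range of [C^T] removes the kernel of [C], so the minimum
of the Rayleigh quotient is a nonzero eigenvalue of [C^T *m C]; its square root
is therefore one of the values over which [sigma_min] takes the infimum. *)
Lemma sigma_min_le (e : 'cV[R]_n) : (exists z, e = C^T *m z) ->
  sigma_min C ^+ 2 * dotp e e <= dotp (C *m e) (C *m e).
Proof.
move=> [z ez]; have Pe : Pi *m e = e by rewrite ez Pi_range.
have [->|e0] := eqVneq e 0; first by rewrite !mulmx0 !dotpE !mulmx0 !mxE mulr0.
have [v [Pv v1 vmin]] := rayleigh_min Pe e0.
have eig := rayleigh_min_eigen Pv v1 vmin.
have v0 : v != 0.
  by apply/eqP => vz; move: v1; rewrite vz dotpE mulmx0 mxE => /esym/eqP;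
     rewrite oner_eq0.
have ray0 : 0 < ray v.
  apply: dotp_gt0; apply: contraNneq v0 => Cv0.
  by rewrite -Pv -mulmxA Cv0 mulmx0.
apply: le_trans (vmin e Pe); apply: ler_wpM2r; first exact: dotp_ge0.
rewrite -[leRHS]sqr_sqrtr; last exact: ltW.
have ex : [set s | singular_value C s /\ s != 0] (Num.sqrt (ray v)).
  split; last by rewrite gt_eqF // sqrtr_gt0.
  split; first exact: sqrtr_ge0.
  rewrite sqr_sqrtr; last exact: ltW.
  apply/eigenvalueP; exists v^T; last by rewrite trmx_eq0.
  by rewrite -linearZ /= -eig !trmx_mul trmxK.
rewrite ler_pXn2r ?nnegrE ?sqrtr_ge0 //.
- by apply: ge_inf ex; exists 0 => s [[]].
- by apply: lb_le_inf; [exists (Num.sqrt (ray v)) | move=> s [[]]].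
Qed.

End Rayleigh.

Lemma sigma_min0 (R : realType) p n : sigma_min (0 : 'M[R]_(p, n)) = 0.
Proof.
rewrite /sigma_min (_ : [set s | _] = set0) ?inf0 //.
apply/seteqP; split=> // s [[_ /eigenvalueP[v]]].
rewrite mulmx0 mulmx0 => /esym/eqP; rewrite scaler_eq0 sqrf_eq0.
by case/orP=> [/eqP-> _|->//]; rewrite eqxx.
Qed.

(** An invertible symmetric [B] gives [B *m A] the row space of [A], so the
previous bound applies to it on the range of [A^T]. Nonnegativity of the form
covers the case where [S] has no positive definite root: the matrix
[spd_sqrt S] is then 0, and so is [sigma_min]. *)
Lemma sigma_min_sqrt_le (R : realType) (m n : nat) (A : 'M[R]_(m, n))
    (S : 'M[R]_m) (e : 'cV[R]_n) :
  (exists z, e = A^T *m z) -> 0 <= dotp (A *m e) (S *m (A *m e)) ->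
  sigma_min (spd_sqrt S *m A) ^+ 2 * dotp e e
    <= dotp (A *m e) (S *m (A *m e)).
Proof.
move=> [z ez] Se0; rewrite /spd_sqrt.
case: xgetP => [B _ [BT Bpos BB]|_]; last first.
  by rewrite mul0mx sigma_min0 expr0n mul0r.
have -> : dotp (A *m e) (S *m (A *m e)) = dotp (B *m A *m e) (B *m A *m e).
  by rewrite -(mulmxA B) [RHS]dotp_mulmxl BT (mulmxA B B) BB.
have uB : B \in unitmx.
  rewrite -row_free_unit -kermx_eq0; apply/rowV0P => u /sub_kermxP uB.
  apply/eqP; apply: contraT => u0; have := Bpos u^T.
  by rewrite trmx_eq0 u0 dotpE trmxK mulmxA uB mul0mx mxE ltxx => /(_ isT).
apply: sigma_min_le; exists (invmx B *m z).
by rewrite trmx_mul BT -mulmxA mulKVmx.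
Qed.

Lemma det_mx22 (R : comPzRingType) (D : 'M[R]_2) :
  \det D = D 0 0 * D 1 1 - D 0 1 * D 1 0.
Proof.
rewrite (expand_det_row _ 0) !big_ord_recl big_ord0 addr0 /cofactor !det_mx11.
rewrite !mxE /= expr0 mul1r expr1 mulN1r mulrN.
by congr (D _ _ * D _ _ - D _ _ * D _ _); apply/val_inj.
Qed.

(** * One relaxed double reflection *)

Section Step.
Variables (R : realType) (m n : nat) (A : 'M[R]_(m, n)).
Hypothesis rows_neq0 : forall i : 'I_m, row i A != 0.
Implicit Types (e : 'cV[R]_n) (i j : 'I_m).

Let sqn i : R := dotp (rowv A i) (rowv A i).
Let gram i j : R := dotp (rowv A i) (rowv A j).

Lemma dotp_rowv i e : dotp (rowv A i) e = (A *m e) i 0.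
Proof. by rewrite mxE; apply: eq_bigr => l _; rewrite !mxE. Qed.

Lemma rowv_dotp_gt0 i : 0 < sqn i.
Proof. by apply: dotp_gt0; rewrite trmx_eq0. Qed.

Let sqn_neq0 i : sqn i != 0. Proof. by rewrite gt_eqF ?rowv_dotp_gt0. Qed.

(** Half the difference between [dotp e e] and the scalar product of [e] with
its image under two reflections, see [dotp_reflection2]. *)
Definition gain e i j : R :=
  (A *m e) i 0 ^+ 2 / dotp (rowv A i) (rowv A i)
  + (A *m e) j 0 ^+ 2 / dotp (rowv A j) (rowv A j)
  - 2 * ((A *m e) i 0 * (A *m e) j 0 * dotp (rowv A i) (rowv A j))
      / (dotp (rowv A i) (rowv A i) * dotp (rowv A j) (rowv A j)).

Let gainE e i j : gain e i j = (A *m e) i 0 ^+ 2 / sqn i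
  + (A *m e) j 0 ^+ 2 / sqn j
  - 2 * ((A *m e) i 0 * (A *m e) j 0 * gram i j) / (sqn i * sqn j).
Proof. by []. Qed.

Lemma gainC e i j : gain e i j = gain e j i.
Proof.
rewrite !gainE (_ : gram j i = gram i j) /gram 1?dotpC //.
by rewrite (mulrC (sqn j)) (mulrC ((A *m e) j 0)) (addrC (_ j 0 ^+ 2 / _)).
Qed.

Lemma gain_diag e i : gain e i i = 0.
Proof. by rewrite gainE /gram -/(sqn i); field. Qed.

(** With right-hand side 0, [reflection] is the linear reflection in the
hyperplane orthogonal to a row; this is how errors evolve. *)
Lemma reflection_err b xs i (x : 'cV[R]_n) : A *m xs = b ->
  reflection A b i x - xs = reflection A 0 i (x - xs).
Proof.
move=> <-; rewrite /reflection -(dotp_rowv i xs) mxE subr0 dotpDr dotpNr.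
by rewrite addrAC.
Qed.

Lemma dotp_reflection i e e' :
  dotp (reflection A 0 i e) e' =
    dotp e e' - 2 * ((A *m e) i 0 * (A *m e') i 0 / sqn i).
Proof.
rewrite /reflection mxE subr0 norm2_sqr -/(sqn i) !dotp_lin !dotp_rowv.
by field.
Qed.

Lemma mul_reflection i j e :
  (A *m reflection A 0 i e) j 0 =
    (A *m e) j 0 - 2 * ((A *m e) i 0 / sqn i) * gram i j.
Proof.
rewrite -!dotp_rowv /reflection mxE subr0 norm2_sqr !dotp_lin.
by rewrite [dotp (rowv A j) (rowv A i)]dotpC.
Qed.

Lemma reflection_isometry i e :
  dotp (reflection A 0 i e) (reflection A 0 i e) = dotp e e.
Proof.
rewrite dotp_reflection dotpC dotp_reflection mul_reflection -/(sqn i).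
by rewrite /gram -/(sqn i); field.
Qed.

Lemma dotp_reflection2 i j e :
  dotp e (reflection A 0 j (reflection A 0 i e)) = dotp e e - 2 * gain e i j.
Proof.
rewrite dotpC !dotp_reflection mul_reflection gainE.
by field; rewrite !sqn_neq0.
Qed.

(** Both terms of the relaxed step have the norm of [e], so only their scalar
product contributes to the decrease. *)
Lemma relaxed_step alpha i j e :
  let e' := (1 - alpha) *: e + alpha *: reflection A 0 j (reflection A 0 i e) in
  dotp e' e' = dotp e e - 4 * alpha * (1 - alpha) * gain e i j.
Proof.
have := dotp_reflection2 i j e.
have := etrans (reflection_isometry j (reflection A 0 i e))
               (reflection_isometry i e).
move: (reflection A 0 j _) => r rr er /=.
by rewrite !dotp_lin rr (dotpC r) er; ring.
Qed.

(** The scalar product of two vectors of equal norm is at most the square of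
that norm. *)
Lemma gain_ge0 e i j : 0 <= gain e i j.
Proof.
have := dotp_reflection2 i j e.
have := etrans (reflection_isometry j (reflection A 0 i e))
               (reflection_isometry i e).
move: (reflection A 0 j _) => r rr er; have := dotp_ge0 (e - r).
by rewrite !dotp_lin rr (dotpC r) er; lra.
Qed.

Lemma reflection_range i e : (exists z, e = A^T *m z) ->
  exists z, reflection A 0 i e = A^T *m z.
Proof.
move=> [z ->]; rewrite /reflection; set c := 2 * _.
exists (z - c *: delta_mx i 0).
by rewrite mulmxBr -scalemxAr -colE /rowv tr_row.
Qed.

(** Cauchy-Schwarz: the minor times [dotp (rowv A j) (rowv A j)] is the square
of the norm of [sqn j *: rowv A i - gram i j *: rowv A j]. *)
Lemma gram_minor_ge0 i j : 0 <= sqn i * sqn j - gram i j ^+ 2.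
Proof.
have := dotp_ge0 (sqn j *: rowv A i - gram i j *: rowv A j).
rewrite !dotp_lin -/(sqn i) -/(sqn j) [dotp (rowv A j) (rowv A i)]dotpC.
rewrite -/(gram i j) => h.
rewrite -(pmulr_rge0 _ (rowv_dotp_gt0 j)); apply: le_trans h _.
by rewrite le_eqVlt; apply/orP; left; apply/eqP; ring.
Qed.

Lemma normF_sqr_rows : normF A ^+ 2 = \sum_i sqn i.
Proof.
rewrite sqr_sqrtr; last by do 2! apply: sumr_ge0 => ? _; exact: sqr_ge0.
by apply: eq_bigr => i _; apply: eq_bigr => l _; rewrite !mxE expr2.
Qed.

Lemma normF_sqr_other_rows i : \sum_(j | j != i) sqn j = normF A ^+ 2 - sqn i.
Proof. by rewrite normF_sqr_rows [in RHS](bigD1 i) //= addrC addrK. Qed.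

Lemma dotp_mulmx_offdiag (S : 'M[R]_m) (y : 'cV[R]_m) :
  dotp y (S *m y) =
    \sum_i y i 0 ^+ 2 * S i i
    + \sum_i \sum_(j | j != i) y i 0 * y j 0 * S i j.
Proof.
rewrite -big_split; apply: eq_bigr => i _ /=.
rewrite mxE (bigD1 i) //= mulrDr; congr (_ + _); first by ring.
by rewrite mulr_sumr; apply: eq_bigr => j _; ring.
Qed.

Lemma exchange_offdiag (F : 'I_m -> 'I_m -> R) :
  \sum_i \sum_(j | j != i) F i j = \sum_i \sum_(j | j != i) F j i.
Proof.
rewrite (exchange_big_dep xpredT) //=.
by apply: eq_bigr => i _; apply: eq_bigl => j; rewrite eq_sym.
Qed.

(** The left side is the mean gain when the second index is drawn among the rows
other than [i]. The weights of the first square sum to 1 over [j], which needs a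
row besides [i] with positive norm; those of the second square sum over [i] to
the summands of [deltaM] for rows other than [j]. Together they are the diagonal
of [matM], and the products [y i 0 * y j 0] are its off-diagonal part. *)
Lemma sum_gain_matM e : (forall i, normF A ^+ 2 != sqn i) ->
  \sum_i \sum_(j | j != i)
    sqn i / normF A ^+ 2 * (sqn j / (normF A ^+ 2 - sqn i)) * gain e i j
  = dotp (A *m e) (matM A *m (A *m e)) / normF A ^+ 2.
Proof.
move=> Fn; set F := normF A ^+ 2 in Fn *; set y := A *m e.
pose w i := (F - sqn i)^-1.
transitivity ((\sum_i \sum_(j | j != i) w i * (sqn j * y i 0 ^+ 2)
   + \sum_i \sum_(j | j != i) w i * sqn i * y j 0 ^+ 2
   + \sum_i \sum_(j | j != i) w i * (- 2 * (y i 0 * y j 0 * gram i j))) / F).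
  rewrite -!big_split [RHS]mulr_suml; apply: eq_bigr => i _ /=.
  rewrite -!big_split [RHS]mulr_suml; apply: eq_bigr => j _ /=.
  rewrite gainE -/y -/(w i); set wi := w i; set z := F^-1.
  by field; rewrite !sqn_neq0.
congr (_ / _); rewrite dotp_mulmx_offdiag; congr (_ + _); last first.
  rewrite exchange_offdiag; apply: eq_bigr => i _; apply: eq_bigr => j ji.
  rewrite [matM A _ _]mxE eq_sym (negPf ji) !norm2_sqr.
  rewrite -/F -/(sqn j) -/(w j) -/(gram i j).
  by rewrite [gram j i]dotpC -/(gram i j); ring.
rewrite [X in _ + X]exchange_offdiag -big_split; apply: eq_bigr => i _ /=.
rewrite [matM A _ _]mxE eqxx norm2_sqr -/F -/(sqn i) -mulr_sumr -!mulr_suml.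
rewrite normF_sqr_other_rows -/F.
have -> : \sum_(j | j != i) w j * sqn j = deltaM A - sqn i / (F - sqn i).
  rewrite /deltaM [in RHS](bigD1 i) //= norm2_sqr -/F -/(sqn i) addrC addrK.
  by apply: eq_bigr => j _; rewrite norm2_sqr mulrC.
rewrite /w; field; by rewrite subr_eq0 Fn.
Qed.

(** The minor is [gN A i j] times the squared norms of both rows, which clears
the denominators of the gain; by symmetry each square contributes once for [i]
and once for [j], hence the factor 2. *)
Lemma sum_gain_matN e :
  \sum_i \sum_j (sqn i * sqn j - gram i j ^+ 2) * gain e i j
  = 2 * dotp (A *m e) (matN A *m (A *m e)).
Proof.
set y := A *m e; pose g i j := gN A i j.
have gC i j : g i j = g j i.
  by rewrite /g /gN [dotp (rowv A j) (rowv A i)]dotpC (mulrC (norm2 _ ^+ 2)).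
have gE i j : g i j = 1 - gram i j ^+ 2 / (sqn i * sqn j).
  by rewrite /g /gN !norm2_sqr.
have g0 i : g i i = 0 by rewrite gE /gram -/(sqn i); field.
transitivity (\sum_i \sum_j g i j * sqn j * y i 0 ^+ 2
   + \sum_i \sum_j g i j * sqn i * y j 0 ^+ 2
   + \sum_i \sum_j - 2 * (g i j * (y i 0 * y j 0 * gram i j))).
  rewrite -!big_split; apply: eq_bigr => i _ /=.
  rewrite -!big_split; apply: eq_bigr => j _ /=.
  rewrite gainE -/y gE.
  by field; rewrite !sqn_neq0.
rewrite [X in _ + X + _]exchange_big /= dotp_mulmx_offdiag mulrDr.
congr (_ + _).
  rewrite -big_split mulr_sumr; apply: eq_bigr => i _ /=.
  rewrite [matN A _ _]mxE eqxx -!mulr_suml.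
  have -> : \sum_j g j i * sqn j = \sum_l gN A i l * norm2 (rowv A l) ^+ 2.
    by apply: eq_bigr => j _; rewrite gC norm2_sqr.
  have -> : \sum_j g i j * sqn j = \sum_l gN A i l * norm2 (rowv A l) ^+ 2.
    by apply: eq_bigr => j _; rewrite norm2_sqr.
  by ring.
rewrite mulr_sumr; apply: eq_bigr => i _.
rewrite mulr_sumr (bigD1 i) //= g0 mul0r mulr0 add0r.
apply: eq_bigr => j ji; rewrite [matN A _ _]mxE eq_sym (negPf ji).
rewrite -/(gram i j) -/(g i j).
by ring.
Qed.

(** Every two-element set arises from exactly two ordered pairs. *)
Lemma sum_pairs (h : {set 'I_m} -> R) :
  \sum_i \sum_(j | j != i) h [set i; j]%SET =
  2 * \sum_(S : {set 'I_m} | #|S| == 2) h S.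
Proof.
rewrite pair_big_dep /=.
rewrite (partition_big (fun p : 'I_m * 'I_m => [set p.1; p.2]%SET)
           (fun S : {set 'I_m} => #|S| == 2)) /=; last first.
  by case=> i j /= ji; rewrite cards2 (eq_sym i) ji.
rewrite mulr_sumr; apply: eq_bigr => S /cards2P[a [b [ab ->]]].
rewrite (bigD1 (a, b)) /=; last by rewrite (eq_sym b) ab eqxx.
rewrite (bigD1 (b, a)) /=; last first.
  by rewrite ab finset.setUC eqxx xpair_eqE (negPf ab) andbF.
rewrite big1 => [|[i j] /=]; first by rewrite finset.setUC; ring.
move=> /andP[/andP[/andP[ji /eqP eS] nab] nba].
have iab : i \in [set a; b]%SET by rewrite -eS !inE eqxx.
have jab : j \in [set a; b]%SET by rewrite -eS !inE eqxx orbT.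
move: iab jab ji nab nba; rewrite !inE !xpair_eqE.
by case/orP=> /eqP-> /orP[]/eqP->; rewrite !eqxx.
Qed.

Lemma vol_pair i j : i != j ->
  vol A [set i; j] = sqn i * sqn j - gram i j ^+ 2.
Proof.
move=> ij; rewrite /vol /sub_rows; set S := [set i; j]%SET.
(* The index type of the minor is ['I_#|S|]; the cardinal has to be a variable
   before it can be replaced by 2. *)
have aux k (f : 'I_k -> 'I_m) : k = 2%N -> injective f ->
    (forall a, f a \in S) ->
    \det (rowsub f A *m (rowsub f A)^T) = sqn i * sqn j - gram i j ^+ 2.
  move=> k2; subst k => finj fS.
  have GE a b : (rowsub f A *m (rowsub f A)^T) a b = gram (f a) (f b).
    by rewrite mxE; apply: eq_bigr => l _; rewrite !mxE.
  rewrite det_mx22 !GE.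
  have : f 0 != f 1 by apply/eqP => /finj.
  have := fS 0; have := fS 1; rewrite !inE.
  case/orP=> /eqP-> /orP[] /eqP->; rewrite ?eqxx // => _.
    by rewrite [gram j i]dotpC expr2 mulrC.
  by rewrite [gram j i]dotpC expr2.
apply: aux; first by rewrite cards2 ij.
  exact: enum_val_inj.
by move=> a; exact: enum_valP.
Qed.

(** The gain as a function of the unordered pair: each pair of distinct elements
is counted in both orders, and the diagonal terms are zero. *)
Definition gain_set e (S : {set 'I_m}) : R :=
  2^-1 * \sum_(i in S) \sum_(j in S) gain e i j.

Lemma gain_set_ge0 e S : 0 <= gain_set e S.
Proof.
by rewrite mulr_ge0 ?invr_ge0 //; do 2! apply: sumr_ge0 => ? _; exact: gain_ge0.
Qed.

Lemma gain_set_pair e i j : gain_set e [set i; j] = gain e i j.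
Proof.
rewrite /gain_set; have [->|ij] := eqVneq i j.
  by rewrite finset.setUid !big_set1 gain_diag mulr0.
rewrite !big_setU1 ?inE //= !big_set1 !big_setU1 ?inE //= !big_set1.
by rewrite !gain_diag (gainC e j i); field.
Qed.

Lemma sum_vol :
  2 * \sum_(S : {set 'I_m} | #|S| == 2) vol A S =
  normF A ^+ 4 - normF (A *m A^T) ^+ 2.
Proof.
rewrite -sum_pairs -[4%N]/(2 * 2)%N exprM [X in _ - X]sqr_sqrtr; last first.
  by do 2! apply: sumr_ge0 => ? _; exact: sqr_ge0.
rewrite normF_sqr_rows expr2 big_distrlr /= -sumrB; apply: eq_bigr => i _.
rewrite -sumrB [RHS](bigD1 i) //=.
have GE a b : (A *m A^T) a b = gram a b.
  by rewrite mxE; apply: eq_bigr => l _; rewrite !mxE.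
rewrite GE expr2 subrr add0r; apply: eq_bigr => j ji.
by rewrite vol_pair 1?eq_sym // GE.
Qed.

Lemma sum_vol_gain e :
  \sum_(S : {set 'I_m} | #|S| == 2) vol A S * gain_set e S =
  dotp (A *m e) (matN A *m (A *m e)).
Proof.
apply: (@mulfI _ 2); first by rewrite pnatr_eq0.
rewrite -sum_gain_matN -sum_pairs; apply: eq_bigr => i _.
rewrite [RHS](bigD1 i) //= gain_diag mulr0 add0r; apply: eq_bigr => j ji.
by rewrite vol_pair 1?eq_sym // gain_set_pair.
Qed.

(** Rank at least 2 forces a second row, and rows are nonzero. *)
Lemma normF_sqr_neq_row : (2 <= \rank A)%N -> forall i, normF A ^+ 2 != sqn i.
Proof.
move=> rk i; have /card_gt1P[j1 [j2 [_ _ j12]]] : (1 < #|'I_m|)%N.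
  by rewrite card_ord (leq_trans rk (rank_leq_row A)).
have [j ji] : exists j, j != i.
  by have [<-|] := eqVneq j1 i; [exists j2; rewrite eq_sym | exists j1].
rewrite -subr_eq0 -normF_sqr_other_rows (bigD1 j) //= gt_eqF //.
rewrite ltr_pwDl ?rowv_dotp_gt0 // sumr_ge0 // => l _.
exact/ltW/rowv_dotp_gt0.
Qed.

Lemma other_rows_ge0 i : 0 <= normF A ^+ 2 - sqn i.
Proof.
rewrite -normF_sqr_other_rows sumr_ge0 // => l _.
exact/ltW/rowv_dotp_gt0.
Qed.

Lemma matM_ge0 e : (forall i, normF A ^+ 2 != sqn i) ->
  0 <= dotp (A *m e) (matM A *m (A *m e)).
Proof.
move=> Fn; have [F0|Fne] := eqVneq (normF A ^+ 2) 0.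
  rewrite /dotp big1 // => i _; exfalso.
  by have := other_rows_ge0 i; have := rowv_dotp_gt0 i; rewrite F0; lra.
rewrite -(pmulr_lge0 (x := (normF A ^+ 2)^-1)); last first.
  by rewrite invr_gt0 lt_def Fne sqr_ge0.
rewrite -sum_gain_matM //; apply: sumr_ge0 => i _; apply: sumr_ge0 => j _.
rewrite mulr_ge0 ?gain_ge0 // mulr_ge0 //;
  rewrite divr_ge0 ?(ltW (rowv_dotp_gt0 _)) ?sqr_ge0 //.
exact: other_rows_ge0.
Qed.

Lemma matN_ge0 e : 0 <= dotp (A *m e) (matN A *m (A *m e)).
Proof.
rewrite -(pmulr_rge0 (x := 2)) // -sum_gain_matN.
do 2! apply: sumr_ge0 => ? _; rewrite mulr_ge0 ?gain_ge0 //.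
exact: gram_minor_ge0.
Qed.

End Step.

(** * Errors of the iterates *)

Section Iteration.
Variables (R : realType) (m n : nat) (A : 'M[R]_(m, n)) (b : 'cV[R]_m).
Variables (alpha : R) (x0 : 'cV[R]_n).
Hypothesis rows_neq0 : forall i : 'I_m, row i A != 0.
Hypothesis consistent : exists x : 'cV[R]_n, A *m x = b.

Let xs := xstar A b x0.

Lemma xstar_sol : A *m xs = b.
Proof.
have [x Ax] := consistent; have [AXA _ _ _] := pinvP A.
rewrite /xs /xstar -Ax mulmxDr !mulmxA mulmxBr mulmx1 mulmxA AXA.
by rewrite subrr mul0mx addr0.
Qed.

Let err s k : 'cV[R]_n := prdr A b alpha x0 s k - xs.

Lemma errS s k : err s k.+1 = (1 - alpha) *: err s k
  + alpha *: reflection A 0 (s k).2 (reflection A 0 (s k).1 (err s k)).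
Proof.
rewrite -!(reflection_err _ _ xstar_sol) /err /=.
rewrite !scalerBr addrACA -opprD -scalerDl subrK scale1r //.
Qed.

(** Initially the error is the projection onto the range of [A^T] of the
difference between [x0] and a solution. *)
Lemma err_range s k : exists z, err s k = A^T *m z.
Proof.
elim: k => [|k [z ez]].
  have [x Ax] := consistent; have [_ _ _ XAT] := pinvP A.
  exists ((Defs.pinv A)^T *m (x0 - x)).
  rewrite mulmxA -trmx_mul XAT /err /= /xs /xstar -Ax.
  rewrite mulmxA mulmxBr mulmxBl mul1mx.
  by rewrite opprD opprB addrCA [x0 + _]addrCA subrr addr0 addrC.
rewrite errS.
have /(reflection_range (s k).1)/(reflection_range (s k).2)[z' ->] :=
  ex_intro (fun z => err s k = A^T *m z) z ez.
by exists ((1 - alpha) *: z + alpha *: z'); rewrite ez mulmxDr -!scalemxAr.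
Qed.

Lemma sqr_errS s k : dotp (err s k.+1) (err s k.+1) =
  dotp (err s k) (err s k)
    - 4 * alpha * (1 - alpha) * gain A (err s k) (s k).1 (s k).2.
Proof. by rewrite errS relaxed_step. Qed.

End Iteration.

Lemma eq_prdr (R : realType) (m n : nat) (A : 'M[R]_(m, n)) b alpha x0 s s' k :
  (forall j, (j < k)%N -> s j = s' j) ->
  prdr A b alpha x0 s k = prdr A b alpha x0 s' k.
Proof.
elim: k => //= k IH ss'; rewrite ss' // IH // => j jk; apply: ss'.
exact: ltnW.
Qed.

(** * Expectations over finite histories *)

(** For negative [c], nonnegativity forces all terms of the sequence to be 0. *)
Lemma geometric_decay (R : realFieldType) (c : R) (u : nat -> R) :
  (forall k, 0 <= u k) -> (forall k, u k.+1 <= c * u k) ->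
  forall k, u k <= c ^+ k * u 0%N.
Proof.
move=> u0 uS; have [c0|c0] := leP 0 c.
  elim=> [|k IH]; first by rewrite mul1r.
  by rewrite exprS -mulrA (le_trans (uS k)) // ler_wpM2l.
have uz k : u k = 0.
  by have := u0 k.+1; have := uS k; have := u0 k; nra.
by move=> k; rewrite !uz mulr0.
Qed.

Section FiniteExpectation.
Context {d : measure_display} {T : measurableType d} {R : realType}.
Variable P : probability T R.

Definition prob (E : set T) : R := fine (P E).

Lemma probE (E : set T) : measurable E -> P E = (prob E)%:E.
Proof. by move=> mE; rewrite fineK // fin_num_measure. Qed.

Lemma prob_ge0 (E : set T) : 0 <= prob E.
Proof. exact: fine_ge0. Qed.

Definition measurable_fibres (J : Type) (F : T -> J) :=
  forall j, measurable [set w | F w = j].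

Lemma measurable_fibres_comp (I : finType) (J : Type) (F : T -> I)
    (f : I -> J) :
  measurable_fibres F -> measurable_fibres (f \o F).
Proof.
move=> mF j.
rewrite (_ : [set w | _] = \bigcup_(i in [set i | f i = j]) [set w | F w = i]).
  by apply: fin_bigcup_measurable => //; exact: finite_finset.
by apply/seteqP; split=> [w /= <-|w [i /= <- ->]//]; exists (F w).
Qed.

Lemma expectation_fin (J : finType) (F : T -> J) (g : J -> R) :
  measurable_fibres F ->
  ('E_P[fun w => g (F w)] = (\sum_j g j * prob [set w | F w = j])%:E)%E.
Proof.
move=> mF; rewrite unlock.
have -> : (fun w => (g (F w))%:E) =
    (fun w => \sum_(j : J) (g j)%:E * (\1_[set w | F w = j] w)%:E)%E.
  apply/funext => w; rewrite (bigD1 (F w)) //= indicE mem_set // mule1.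
  rewrite big1 ?adde0 // => j jF; rewrite indicE memNset ?mule0 //=.
  by apply/eqP; rewrite eq_sym.
rewrite integral_sum //; last first.
  by move=> j; apply: integrableZl => //; exact: integrable_indic.
rewrite -sumEFin; apply: eq_bigr => j _.
rewrite integralZl //; last exact: integrable_indic.
by rewrite integral_indic // setIT EFinM -probE.
Qed.

Lemma sum_prob (J : finType) (F : T -> J) :
  measurable_fibres F -> \sum_j prob [set w | F w = j] = 1.
Proof.
move=> mF; apply/EFin_inj.
under eq_bigr do rewrite -[prob _]mul1r.
by rewrite -(expectation_fin (fun=> 1) mF) expectation_cst.
Qed.

End FiniteExpectation.

Section Chain.
Context {d : measure_display} {T : measurableType d} {R : realType}.
Variable P : probability T R.
Variables (U V : finType) (X : nat -> T -> U) (Y : nat -> T -> V) (v0 : V).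
Hypothesis mX : forall k, measurable_fibres (X k).
Hypothesis mY : forall k, measurable_fibres (Y k).
Hypothesis indepXY : indep_past P X Y.

Definition past_only (W : Type) (k : nat) (f : (nat -> V) -> W) :=
  forall s s', (forall j, (j < k)%N -> s j = s' j) -> f s = f s'.

Let hist k w : k.-tuple V := [tuple Y j w | j < k].
Let ext k (h : k.-tuple V) : nat -> V := nth v0 h.

Let ext_hist k w j : (j < k)%N -> ext (hist k w) j = Y j w.
Proof.
by move=> jk; rewrite /ext -[j]/(val (Ordinal jk)) -tnth_nth tnth_mktuple.
Qed.

Let histE k h :
  [set w | hist k w = h] = [set w | forall j, (j < k)%N -> Y j w = ext h j].
Proof.
apply/seteqP; split=> w /= => [<- j jk|hw]; first by rewrite ext_hist.
apply: eq_from_tnth => j; rewrite (tnth_nth v0) (tnth_nth v0).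
by rewrite -/(ext h j) -hw // -(@ext_hist k).
Qed.

Let mhist k : measurable_fibres (hist k).
Proof.
move=> h; rewrite histE.
rewrite (_ : [set w | _] = \bigcap_(j in `I_k) [set w | Y j w = ext h j]) //.
by apply: fin_bigcap_measurable => // j _; exact: mY.
Qed.

Let past_only_hist (W : Type) k (f : (nat -> V) -> W) w : past_only k f ->
  f (Y^~ w) = f (ext (hist k w)).
Proof. by move=> fk; apply: fk => j jk; rewrite ext_hist. Qed.

Lemma expectation_past k (f : (nat -> V) -> R) : past_only k f ->
  ('E_P[fun w => f (Y^~ w)] =
   (\sum_h f (ext h) * prob P [set w | hist k w = h])%:E)%E.
Proof.
move=> fk; rewrite -(expectation_fin P (f \o @ext k) (@mhist k)).
by congr expectation; apply/funext => w /=; exact: past_only_hist.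
Qed.

(** Integrating a function of the past and of the next draw: by independence the
draw can be averaged first, with the history held fixed. *)
Lemma expectation_step k (f : (nat -> V) -> U -> R) : past_only k f ->
  ('E_P[fun w => f (Y^~ w) (X k w)] =
   (\sum_h (\sum_u f (ext h) u * prob P [set w | X k w = u])
      * prob P [set w | hist k w = h])%:E)%E.
Proof.
move=> fk; pose F w := (hist k w, X k w).
have FE h u : [set w | F w = (h, u)] =
    [set w | X k w = u] `&` [set w | hist k w = h].
  by apply/seteqP; split=> w /= [eh eu]; rewrite /F ?eh ?eu.
have mF : measurable_fibres F.
  by case=> h u; rewrite FE; apply: measurableI; [exact: mX|exact: mhist].
have -> : (fun w => f (Y^~ w) (X k w)) =
    (fun w => (fun p => f (ext p.1) p.2) (F w)).
  by apply/funext => w /=; rewrite (past_only_hist w fk).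
rewrite (expectation_fin P (fun p => f (ext p.1) p.2) mF); congr EFin.
transitivity (\sum_h \sum_u f (ext h) u * prob P [set w | F w = (h, u)]).
  by rewrite pair_bigA; apply: eq_bigr => -[].
apply: eq_bigr => h _ /=; rewrite mulr_suml; apply: eq_bigr => u _.
rewrite -mulrA; congr (_ * _); apply/EFin_inj.
have mXu := mX k u; have mhk := @mhist k h; have mFhu := mF (h, u).
by rewrite EFinM -!probE // FE histE indepXY.
Qed.

(** Averaged over the next draw with the history held fixed, the decrease is at
least [c] times the current value, and [expectation_step] passes this to the
mean. The draw [X k] may carry less information than [Y k], and it is then the
only part of [Y k] that is independent of the past. *)
Lemma chain_contraction (c : R) (phi : nat -> (nat -> V) -> R)
    (D : nat -> (nat -> V) -> U -> R) (a : R) :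
  (forall k, past_only k (phi k)) -> (forall k, past_only k (D k)) ->
  (forall k s, 0 <= phi k s) -> (forall s, phi 0%N s = a) ->
  (forall k w, phi k.+1 (Y^~ w) = phi k (Y^~ w) - D k (Y^~ w) (X k w)) ->
  (forall k s,
     c * phi k s <= \sum_u D k s u * prob P [set w | X k w = u]) ->
  forall k, ('E_P[fun w => phi k (Y^~ w)] <= ((1 - c) ^+ k * a)%:E)%E.
Proof.
move=> phil Dl phi0 phia phiS Dc.
pose u k := \sum_h phi k (ext h) * prob P [set w | hist k w = h].
have uE k : ('E_P[fun w => phi k (Y^~ w)] = (u k)%:E)%E.
  by rewrite (expectation_past (phil k)).
have u0 : u 0%N = a.
  apply/EFin_inj; rewrite -uE -(expectation_cst P a).
  by congr expectation; apply/funext => w; rewrite phia.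
move=> k; rewrite uE lee_fin -u0; move: k.
apply: geometric_decay => k.
  by apply: sumr_ge0 => h _; rewrite mulr_ge0 ?prob_ge0.
rewrite -lee_fin -uE.
under [fun w => phi k.+1 _]eq_fun do rewrite phiS.
rewrite (@expectation_step k (fun s x => phi k s - D k s x)); last first.
  by move=> s s' ss'; rewrite (phil k _ _ ss') (Dl k _ _ ss').
rewrite lee_fin /u mulr_sumr; apply: ler_sum => h _.
rewrite mulrA ler_wpM2r ?prob_ge0 //.
under eq_bigr do rewrite mulrBl.
rewrite sumrB -mulr_sumr sum_prob // mulr1 mulrBl mul1r lerD2l lerN2.
exact: Dc.
Qed.

End Chain.

(** * Convergence under the two sampling strategies *)

Section Convergence.
Variables (R : realType) (m n : nat) (A : 'M[R]_(m, n)) (b : 'cV[R]_m).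
Variables (alpha : R) (x0 : 'cV[R]_n).
Context {d : measure_display} {T : measurableType d}.
Variables (P : probability T R) (idx : nat -> T -> 'I_m * 'I_m).
Hypothesis rows_neq0 : forall i : 'I_m, row i A != 0.
Hypothesis rank_ge2 : (2 <= \rank A)%N.
Hypothesis consistent : exists x : 'cV[R]_n, A *m x = b.
Hypothesis alpha01 : 0 < alpha < 1.
Hypothesis midx : measurable_indices idx.

Let xs := xstar A b x0.
Let x k w := prdr A b alpha x0 (fun j => idx j w) k.

(** [X k] is the part of the draw that is independent of the past: the ordered
pair for Strategy I and the unordered one for Strategy II. Since the gain is
symmetric, both determine it. *)
Lemma prdr_contraction (U : finType) (X : nat -> T -> U)
    (G : 'cV[R]_n -> U -> R) (c : R) :
  (forall k, measurable_fibres (X k)) -> indep_past P X idx ->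
  (forall k e w, gain A e (idx k w).1 (idx k w).2 = G e (X k w)) ->
  (forall k e, (exists z, e = A^T *m z) ->
     c * dotp e e <= \sum_u G e u * prob P [set w | X k w = u]) ->
  forall k, ('E_P[fun w => (norm2 (x k w - xs) ^+ 2)%R] <=
    ((1 - 4 * alpha * (1 - alpha) * c) ^+ k * norm2 (x0 - xs) ^+ 2)%:E)%E.
Proof.
move=> mX iX gG Gc k.
have i0 : 'I_m.
  by apply: (Ordinal (n := m) (m := 0)); apply: leq_trans (rank_leq_row A);
     apply: leq_trans rank_ge2.
pose err s j := prdr A b alpha x0 s j - xs.
have err_local s s' j :
    (forall l, (l < j)%N -> s l = s' l) -> err s j = err s' j.
  by move=> ss'; rewrite /err (eq_prdr _ _ _ _ ss').
have al0 : 0 <= 4 * alpha * (1 - alpha).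
  by case/andP: alpha01 => a0 a1; rewrite !mulr_ge0 // ?subr_ge0 ltW.
apply: (@chain_contraction _ _ _ P U _ X idx (i0, i0) mX midx iX _
  (fun j s => norm2 (err s j) ^+ 2)
  (fun j s u => 4 * alpha * (1 - alpha) * G (err s j) u)) => //.
- by move=> j s s' ss'; rewrite (err_local _ _ _ ss').
- by move=> j s s' ss'; rewrite (err_local _ _ _ ss').
- by move=> j s; rewrite sqr_ge0.
- move=> j w; rewrite !norm2_sqr -gG.
  exact: (sqr_errS _ _ rows_neq0 consistent).
- move=> j s; rewrite norm2_sqr -mulrA.
  under eq_bigr do rewrite -mulrA.
  rewrite -mulr_sumr ler_wpM2l // Gc //.
  exact: err_range.
Qed.

(** Pairs with equal entries have gain 0, so only the conditional law of the
second index outside the first one enters. *)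
Lemma strategyI_gain k e : strategyI P A idx ->
  \sum_p gain A e p.1 p.2 * prob P [set w | idx k w = p] =
  dotp (A *m e) (matM A *m (A *m e)) / normF A ^+ 2.
Proof.
move=> [_ _ P1 P2]; rewrite -(sum_gain_matM rows_neq0); last first.
  exact: normF_sqr_neq_row.
transitivity (\sum_i \sum_j gain A e i j * prob P [set w | idx k w = (i, j)]).
  by rewrite pair_bigA; apply: eq_bigr => -[].
apply: eq_bigr => i _; rewrite (bigD1 i) //= gain_diag // mul0r add0r.
apply: eq_bigr => j ji; rewrite mulrC; congr (_ * _).
rewrite -!norm2_sqr -(P2 k i j ji) /cond_prob.
rewrite (_ : _ `&` _ = [set w | idx k w = (i, j)]); last first.
  by apply/seteqP; split=> [u /= []|u /= ->//]; case: (idx k u) => ? ? /= -> ->.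
rewrite P1 [fine (_%:E)]/= mulrCA divff ?mulr1 //.
have s0 := rowv_dotp_gt0 rows_neq0 i; rewrite norm2_sqr mulf_neq0 //.
  by rewrite gt_eqF.
rewrite invr_eq0 gt_eqF //.
by have := other_rows_ge0 rows_neq0 i; lra.
Qed.

(** The law of [idx_set] is prescribed on two-element sets; the terms of all
other sets are nonnegative and can be dropped. *)
Lemma strategyII_gain k e : strategyII P A idx ->
  dotp (A *m e) (matN A *m (A *m e))
      / \sum_(J : {set 'I_m} | #|J| == 2) vol A J
    <= \sum_S gain_set A e S * prob P [set w | idx_set idx k w = S].
Proof.
move=> [_ _ PS]; rewrite -sum_vol_gain //.
rewrite [leRHS](bigID (fun S : {set 'I_m} => #|S| == 2)) /=.
rewrite mulr_suml -[leLHS]addr0; apply: lerD.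
  rewrite le_eqVlt; apply/orP; left; apply/eqP.
  apply: eq_bigr => S /eqP S2; rewrite /prob PS //= mulrAC mulrC mulrA //.
by apply: sumr_ge0 => S _; rewrite mulr_ge0 ?gain_set_ge0 ?prob_ge0.
Qed.

End Convergence.

Theorem theorem3p2 (R : realType) (m n : nat)
    (A : 'M[R]_(m, n)) (b : 'cV[R]_m) (alpha : R) (x0 : 'cV[R]_n)
    (d : measure_display) (T : measurableType d) (P : probability T R)
    (idx : nat -> T -> 'I_m * 'I_m)
    (rows_neq0 : forall i : 'I_m, row i A != 0)
    (rank_ge2 : (2 <= \rank A)%N)
    (consistent : exists x : 'cV[R]_n, A *m x = b)
    (alpha01 : 0 < alpha < 1) :
  let xs := xstar A b x0 in
  let x := fun (k : nat) (w : T) => prdr A b alpha x0 (fun j => idx j w) k in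
  (strategyI P A idx ->
    forall k : nat,
      ('E_P[fun w => (norm2 (x k w - xs) ^+ 2)%R] <=
       ((1 - 4 * alpha * (1 - alpha) *
           (sigma_min (sqrtM A *m A) ^+ 2 / normF A ^+ 2)) ^+ k
        * norm2 (x0 - xs) ^+ 2)%:E)%E)
  /\
  (strategyII P A idx ->
    forall k : nat,
      ('E_P[fun w => (norm2 (x k w - xs) ^+ 2)%R] <=
       ((1 - 8 * alpha * (1 - alpha) *
           (sigma_min (sqrtN A *m A) ^+ 2
              / (normF A ^+ 4 - normF (A *m A^T) ^+ 2))) ^+ k
        * norm2 (x0 - xs) ^+ 2)%:E)%E).
Proof.
move=> xs x; split=> strat.
- have [midx indep _ _] := strat.
  apply: (prdr_contraction x0 rows_neq0 rank_ge2 consistent alpha01 midx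
    (G := fun e p => gain A e p.1 p.2) midx indep) => // k e eA.
  rewrite (strategyI_gain rows_neq0 rank_ge2 _ _ strat) mulrAC.
  rewrite ler_wpM2r ?invr_ge0 ?sqr_ge0 //.
  have symM (y : 'cV_m) : dotp y (sympart (matM A) *m y) = dotp y (matM A *m y).
    rewrite /sympart -scalemxAl mulmxDl !dotp_lin -dotp_mulmxl (dotpC _ y).
    by field.
  rewrite -symM; apply: sigma_min_sqrt_le => //.
  by rewrite symM matM_ge0 //; exact: normF_sqr_neq_row.
- have [midx indep _] := strat; move=> k.
  set V := \sum_(J : {set 'I_m} | #|J| == 2) vol A J.
  have -> : 8 * alpha * (1 - alpha) * (sigma_min (sqrtN A *m A) ^+ 2
      / (normF A ^+ 4 - normF (A *m A^T) ^+ 2)) =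
      4 * alpha * (1 - alpha) * (sigma_min (sqrtN A *m A) ^+ 2 / V).
    by rewrite -sum_vol -/V invfM; move: V^-1 => v; field.
  move: k.
  apply: (prdr_contraction x0 rows_neq0 rank_ge2 consistent alpha01 midx
    (G := gain_set A) _ indep) => // [k|k e w|k e eA].
  + exact: (measurable_fibres_comp (fun p => [set p.1; p.2]%SET) (midx k)).
  + by rewrite gain_set_pair.
  + apply: le_trans (strategyII_gain rows_neq0 k e strat); rewrite mulrAC.
    rewrite ler_wpM2r ?invr_ge0 //; last first.
      by apply: sigma_min_sqrt_le => //; exact: matN_ge0.
    apply: sumr_ge0 => S /cards2P[i [j [ij ->]]].
    by rewrite vol_pair ?gram_minor_ge0.
Qed.
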